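(* Let $n\ge 9$. Among all unicyclic graphs with $n$ vertices whose unique cycle is a triangle, $$F(G_{3,1}^{(n)}) > F(G_{3,2}^{(n)}) > F(G_{3,1}^{'(n)}) > F(G_{3,3}^{(n)}) > F(G_{3,4}^{(n)}) > F(R_{k,l})$$ for all integers $k\ge 1$, $l\ge 2$ with $k+l+3=n$, and every such graph not isomorphic to one of $G_{3,1}^{(n)},G_{3,2}^{(n)},G_{3,1}^{'(n)},G_{3,3}^{(n)},G_{3,4}^{(n)}$ has F-index less than $F(G_{3,4}^{(n)})$.
   Context: All graphs are finite and simple. The F-index of a graph $G$ is $F(G)=\sum_{v\in V(G)} d_G(v)^3$. A unicyclic graph is a connected graph with exactly one cycle. Attaching a leaf to a vertex means adding a new vertex adjacent only to it. $G_{3,1}^{(n)}$: triangle with $n-3$ leaves attached to one vertex. $G_{3,2}^{(n)}$: triangle with $n-4$ leaves attached to one vertex and one leaf attached to another vertex. $G_{3,1}^{'(n)}$: obtained from $G_{3,1}^{(n-1)}$ by attaching a new leaf to one of its leaves. $G_{3,3}^{(n)}$: triangle $xyz$ with $n-5$ leaves at $x$ and $2$ leaves at $y$. $G_{3,4}^{(n)}$: triangle $xyz$ with $n-5$ leaves at $x$, one leaf at $y$, one leaf at $z$. $R_{k,l}$ ($k,l\ge1$): triangle $xyz$ with $k$ pendant vertices attached to $z$, one of which receives $l$ additional new leaves; it has $k+l+3$ vertices. *)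

(* Defs.v *)
From mathcomp Require Import all_boot.

Set Implicit Arguments.
Unset Strict Implicit.
Unset Printing Implicit Defensive.

Record sgraph := SGraph {
  vertex :> finType;
  adj : rel vertex;
  adj_sym : symmetric adj;
  adj_irr : irreflexive adj
}.
Arguments adj {s}.

Definition deg (G : sgraph) (v : G) : nat := #|[set u : G | adj v u]|.

Definition Findex (G : sgraph) : nat := \sum_(v : G) deg v ^ 3.

Definition isomorphic (G H : sgraph) : Prop :=
  exists2 f : G -> H, bijective f & {mono f : x y / adj x y}.

Definition connected (G : sgraph) : Prop := forall x y : G, connect adj x y.

(* A cycle is a subgraph, represented by its set of edges, so that the closed
   vertex sequences differing by rotation or reversal give the same cycle. *)
Definition cycle_edges (G : sgraph) (c : seq G) : {set {set G}} :=
  [set [set x; next c x] | x in c].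

Definition is_cycle (G : sgraph) (C : {set {set G}}) : Prop :=
  exists c : seq G, [/\ 3 <= size c, ucycle adj c & C = cycle_edges c].

Definition unicyclic (G : sgraph) : Prop :=
  connected G /\ exists! C : {set {set G}}, is_cycle C.

Definition triangle_unicyclic (n : nat) (G : sgraph) : Prop :=
  [/\ #|G| = n, unicyclic G
    & forall C : {set {set G}}, is_cycle C -> #|C| = 3].

Definition triangle_adj : rel 'I_3 := fun x y => x != y.

Fact triangle_adj_sym : symmetric triangle_adj.
Proof. by move=> x y; rewrite /triangle_adj eq_sym. Qed.

Fact triangle_adj_irr : irreflexive triangle_adj.
Proof. by move=> x; rewrite /triangle_adj eqxx. Qed.

Definition triangle : sgraph := SGraph triangle_adj_sym triangle_adj_irr.

Definition tx : triangle := @Ordinal 3 0 isT.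
Definition ty : triangle := @Ordinal 3 1 isT.
Definition tz : triangle := @Ordinal 3 2 isT.

Section AttachLeaves.
Variables (G : sgraph) (v : G) (k : nat).

Definition attach_adj : rel (G + 'I_k)%type := fun a b =>
  match a, b with
  | inl x, inl y => adj x y
  | inl x, inr _ => x == v
  | inr _, inl y => y == v
  | inr _, inr _ => false
  end.

Fact attach_adj_sym : symmetric attach_adj.
Proof. by move=> [x|i] [y|j] //=; rewrite adj_sym. Qed.

Fact attach_adj_irr : irreflexive attach_adj.
Proof. by move=> [x|i] //=; rewrite adj_irr. Qed.

(* The vertices of G are [inl x]; the k new leaves at v are [inr i]. *)
Definition attach_leaves : sgraph := SGraph attach_adj_sym attach_adj_irr.

End AttachLeaves.

Definition G31 (n : nat) : sgraph := attach_leaves tx (n - 3).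

Definition G32 (n : nat) : sgraph :=
  @attach_leaves (attach_leaves tx (n - 4)) (inl ty) 1.

(* [i] is the leaf of [G31 (n - 1)] that receives the new leaf; all choices of
   [i] give isomorphic graphs. *)
Definition G31' (n : nat) (i : 'I_(n - 1 - 3)) : sgraph :=
  @attach_leaves (G31 (n - 1)) (inr i) 1.

Definition G33 (n : nat) : sgraph :=
  @attach_leaves (attach_leaves tx (n - 5)) (inl ty) 2.

Definition G34 (n : nat) : sgraph :=
  @attach_leaves (@attach_leaves (attach_leaves tx (n - 5)) (inl ty) 1)
    (inl (inl tz)) 1.

(* [w] is the pendant vertex at [tz] that receives the [l] new leaves; all
   choices of [w] give isomorphic graphs. *)
Definition Rgraph (k l : nat) (w : 'I_k) : sgraph :=
  @attach_leaves (attach_leaves tz k) (inr w) l.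

(* Main.v *)
(** The edges of a unicyclic graph outside its cycle are bridges, so growing a
    vertex set from the triangle adds one edge per new vertex and the degrees
    sum to [2n].  The excesses [deg v - 1] therefore sum to [n].  Let [m] be a
    vertex of maximal degree and [a], [b] two triangle vertices other than [m],
    each of excess at least 1.  Convexity of the cube and [n >= 9] show that
    [F(G) >= F(G34)] leaves only seven possible triples formed by the degrees of
    [a], [b] and the total excess of the remaining vertices.  In each of them
    [m] lies on the triangle and at most one vertex off the triangle is not a
    leaf, which determines the graph. *)

Require Import Defs.
From mathcomp Require Import all_boot perm zify.

Set Implicit Arguments.
Unset Strict Implicit.
Unset Printing Implicit Defensive.

(** * Cycles *)

(** With x rotated to the front, the first three entries are distinct. This absence of backtracking
    gives the number of edges of a cycle and keeps leaves off cycles. *)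
Lemma next_next_neq (T : eqType) (c : seq T) x :
  uniq c -> 3 <= size c -> x \in c -> next c (next c x) != x.
Proof.
move=> Uc sz_c /rot_to[i s def_c]; rewrite -!(next_rot i Uc).
move: Uc sz_c; rewrite -(rot_uniq i) -(size_rot i) {}def_c.
case: s => [|y [|z s]] //= /andP[]; rewrite !inE !negb_or.
by case/and3P=> xy xz _ _ _; rewrite eqxx [y == x]eq_sym (negbTE xy) eqxx eq_sym.
Qed.

(** Two distinct vertices giving the same edge would each be the successor of the other, which is
    backtracking. *)
Lemma card_cycle_edges (G : sgraph) (c : seq G) :
  uniq c -> 3 <= size c -> #|cycle_edges c| = size c.
Proof.
move=> Uc sz_c; rewrite card_in_imset; first exact/card_uniqP.
move=> x y cx cy Exy; apply/eqP/negP=> /negP neq_xy.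
have : x \in [set y; next c y] by rewrite -Exy set21.
have : y \in [set x; next c x] by rewrite Exy set21.
rewrite !inE (negbTE neq_xy) eq_sym (negbTE neq_xy) /= => /eqP Ey /eqP Ex.
by have := next_next_neq Uc sz_c cx; rewrite -Ey -Ex eqxx.
Qed.

Lemma cycle_edges_sub (G : sgraph) (c : seq G) (A : {set G}) :
  A \in cycle_edges c -> {subset A <= c}.
Proof.
by case/imsetP=> x cx -> y; rewrite !inE => /orP[]/eqP-> //; rewrite mem_next.
Qed.

(** A simple path from u to v that avoids the edge uv closes up with this edge to a cycle, and that
    cycle can only be C. *)
Lemma unicyclic_bridge (G : sgraph) (C : {set {set G}}) (u v : G) :
  (forall C', is_cycle C' -> C' = C) -> adj u v ->
  connect [rel a b | adj a b && ([set a; b] != [set u; v])] u v ->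
  [set u; v] \in C.
Proof.
move=> uniqC uv /connectP[p0 path_p0].
case/shortenP: path_p0 => p path_p Up _ /esym lastp.
have path_adj : path adj u p by apply: sub_path path_p => a b /andP[].
have sz_c : 3 <= size (u :: p).
  case: p lastp path_p {path_adj Up} => [|w [|//]] /=.
    by move=> Euv; rewrite Euv adj_irr in uv.
  by move=> ->; rewrite eqxx andbF.
rewrite -(uniqC (cycle_edges (u :: p))).
  apply/imsetP; exists v; first by rewrite -lastp mem_last.
  (* As v is the last entry, its index lies out of range and [nth] returns its default, the head u:
     this is the closing edge. *)
  rewrite next_nth -lastp mem_last index_last // nth_default // lastp.
  exact: setUC.
exists (u :: p); split=> //.
by rewrite /ucycle Up andbT /= rcons_path path_adj lastp adj_sym.
Qed.

(** * Edge counting *)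

Lemma degE (G : sgraph) (v : G) : deg v = \sum_u adj v u.
Proof.
rewrite /deg -sum1_card big_mkcond /=.
by apply: eq_bigr => u _; rewrite inE; case: adj.
Qed.

Section Counting.
Variables (G : sgraph) (C : {set {set G}}) (S0 : {set G}).
Hypotheses (connG : connected G) (uniqC : forall C', is_cycle C' -> C' = C).
Hypothesis (C_sub : forall A, A \in C -> A \subset S0).

(** Ordered pairs are counted, so each edge inside S contributes 2, and on the whole vertex set the
    value is the degree sum. *)
Definition edge_count (S : {set G}) := \sum_(a in S) \sum_(b in S) adj a b.

Definition connected_in (S : {set G}) :=
  {in S &, forall a b, connect [rel a b : G | [&& a \in S, b \in S & adj a b]] a b}.

Lemma exists_boundary_edge (S : {set G}) : S != set0 -> S != setT ->
  exists u v, [/\ u \in S, v \notin S & adj u v].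
Proof.
case/set0Pn=> s Ss; rewrite -subTset => /subsetPn[w _ S'w].
have [/existsP[u /existsP[v /and3P[]]]|] :=
    boolP [exists u, exists v, [&& u \in S, v \notin S & adj u v]].
  by exists u, v.
rewrite negb_exists => /forallP noedge.
have noedge' u v : u \in S -> adj u v -> v \in S.
  move=> Su uv; have := noedge u; rewrite negb_exists => /forallP/(_ v).
  by rewrite Su uv andbT negbK.
have clS : closed adj S.
  move=> x y xy; apply/idP/idP => [/noedge'|/noedge']; apply=> //.
  by rewrite adj_sym.
by have := closed_connect clS (connG s w); rewrite Ss (negbTE S'w).
Qed.

(** Given a second neighbour w of v in S, one could go from u to w inside S and on to v without the
    edge uv. This edge would then belong to C, whose edges lie inside S, although v does not. *)
Lemma unique_attachment (S : {set G}) u v : S0 \subset S -> connected_in S ->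
  u \in S -> v \notin S -> adj u v -> {in S, forall w, adj w v = (w == u)}.
Proof.
move=> S0S connS Su S'v uv w Sw; apply/idP/eqP=> [wv|-> //].
apply/eqP/negP=> /negP neq_wu.
suff: [set u; v] \in C.
  apply/negP; apply: contra S'v.
  by move=> /C_sub/subsetP/(_ v); rewrite set22 => /(_ isT); apply: (subsetP S0S).
apply: unicyclic_bridge uniqC uv _.
apply: (@connect_trans _ _ w).
  apply: connect_sub (connS _ _ Su Sw) => a b /= /and3P[Sa Sb ab].
  apply: connect1; rewrite /= ab; apply/negP=> /eqP/setP/(_ v).
  by rewrite set22 !inE => /orP[]/eqP Ev; move: S'v; rewrite Ev ?Sa ?Sb.
apply: connect1; rewrite /= wv; apply/negP=> /eqP/setP/(_ w).
rewrite set21 !inE (negbTE neq_wu) => /esym/eqP Ew.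
by move: S'v; rewrite -Ew Sw.
Qed.

(** The new vertex v is the outer end of a boundary edge. It has a single neighbour in S, so one
    edge, that is two ordered pairs, is gained. *)
Lemma grow_subtree (S : {set G}) : S0 \subset S -> connected_in S ->
  S != set0 -> S != setT ->
  exists v, [/\ v \notin S, connected_in (v |: S)
              & edge_count (v |: S) = edge_count S + 2].
Proof.
move=> S0S connS S_n0 S_nT.
have [u [v [Su S'v uv]]] := exists_boundary_edge S_n0 S_nT.
have attach := unique_attachment S0S connS Su S'v uv.
exists v; split=> //.
  have symr : connect_sym
      [rel a b : G | [&& a \in v |: S, b \in v |: S & adj a b]].
    by apply: sym_connect_sym => a b /=; rewrite adj_sym andbCA.
  suff to_u a : a \in v |: S ->
      connect [rel a b : G | [&& a \in v |: S, b \in v |: S & adj a b]] a u.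
    move=> a b /to_u au /to_u bu; apply: connect_trans au _; by rewrite symr.
  case/setU1P=> [->|Sa].
    by apply: connect1; rewrite /= !inE eqxx Su orbT adj_sym.
  apply: connect_sub (connS _ _ Sa Su) => x y /and3P[Sx Sy xy].
  by apply: connect1; rewrite /= !inE Sx Sy xy !orbT.
have sum_v : \sum_(a in S) adj a v = 1.
  rewrite (bigD1 u) //= uv big1 // => a /andP[Sa /negbTE].
  by rewrite attach // => ->.
have sum_v' : \sum_(b in S) adj v b = 1.
  by rewrite -sum_v; apply: eq_bigr => b _; rewrite adj_sym.
rewrite /edge_count big_setU1 //= big_setU1 //= adj_irr sum_v' add0n.
under eq_bigr => a _ do rewrite big_setU1 //=.
by rewrite big_split /= sum_v addnA addnC.
Qed.

(** Each growth step raises [edge_count S] by 2 and the size of S by 1, so the equation that holds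
    at [S0] persists until S is the whole vertex set. *)
Lemma sum_deg_growth : S0 != set0 -> connected_in S0 ->
  edge_count S0 = #|S0|.*2 -> \sum_(v : G) deg v = #|G|.*2.
Proof.
move=> S0_n0 conn0 cnt0.
have grow k : #|S0| + k <= #|G| -> exists S : {set G},
    [/\ S0 \subset S, #|S| = #|S0| + k, connected_in S & edge_count S = #|S|.*2].
  elim: k => [|k IHk] lek; first by exists S0; rewrite addn0.
  have [|S [S0S cardS connS cntS]] := IHk; first by lia.
  have S_n0 : S != set0 by apply: contraNneq S0_n0 => ES; rewrite -subset0 -ES.
  have S_nT : S != setT.
    by apply: contraTneq lek => ES; rewrite addnS -cardS ES cardsT ltnn.
  have [v [S'v connvS cntvS]] := grow_subtree S0S connS S_n0 S_nT.
  exists (v |: S); split=> //; first exact: subset_trans (subsetUr _ _).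
    by rewrite cardsU1 S'v; lia.
  by rewrite cntvS cntS cardsU1 S'v; lia.
have [|S [_ cardS _ cntS]] := grow (#|G| - #|S0|).
  by rewrite subnKC ?max_card.
have ES : S = setT.
  apply/eqP; rewrite eqEcard subsetT cardsT cardS subnKC ?max_card //=.
rewrite -cardsT -ES -cntS ES /edge_count.
by apply: eq_big => [v|v _]; rewrite ?inE // degE; apply: eq_bigl => u; rewrite inE.
Qed.

End Counting.

(** * Attaching leaves *)

Section Attach.
Variables (G : sgraph) (v : G) (k : nat).
Local Notation H := (attach_leaves v k).

Lemma card_attach : #|H| = #|G| + k.
Proof. by rewrite card_sum card_ord. Qed.

Lemma deg_attach_inl (x : G) : @deg H (inl x) = deg x + (x == v) * k.
Proof.
rewrite !degE big_sumType /=; congr (_ + _).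
by rewrite sum_nat_const card_ord mulnC.
Qed.

Lemma deg_attach_inr (i : 'I_k) : @deg H (inr i) = 1.
Proof.
rewrite degE big_sumType /= [X in _ + X]big1 // addn0.
by rewrite (bigD1 v) //= eqxx big1 // => x /negbTE->.
Qed.

(** Only the degree of v changes, and each new leaf adds 1. The truncated subtraction is exact
    because cubing is monotone. *)
Lemma Findex_attach :
  Findex H = Findex G + ((deg v + k) ^ 3 - deg v ^ 3) + k.
Proof.
rewrite /Findex big_sumType /=; congr (_ + _); last first.
  under eq_bigr => i _ do rewrite deg_attach_inr.
  by rewrite sum_nat_const card_ord muln1.
rewrite (bigD1 v) //= deg_attach_inl eqxx mul1n [in RHS](bigD1 v) //=.
rewrite (eq_bigr (fun x => deg x ^ 3)) => [|x /negbTE neq_xv].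
  by have : deg v ^ 3 <= (deg v + k) ^ 3; [rewrite leq_exp2r ?leq_addr|lia].
by rewrite deg_attach_inl neq_xv addn0.
Qed.

Lemma connected_attach : connected G -> connected H.
Proof.
move=> connG.
have symH : connect_sym (@adj H) by apply: sym_connect_sym (@adj_sym H).
suff to_v (a : H) : connect adj a (inl v : H).
  by move=> a b; apply: connect_trans (to_v a) _; rewrite symH.
case: a => [x|i]; last by apply: connect1; rewrite /= eqxx.
have /connectP[p path_p ->] := connG x v; apply/connectP; exists (map inl p).
  by elim: p x path_p => //= y p IHp x /andP[-> /IHp].
by rewrite (last_map (inl : G -> H)).
Qed.

(** On a cycle the predecessor and the successor of a leaf would both be its only neighbour, which
    is backtracking. So no new leaf lies on a cycle. *)
Lemma attach_cycle (c : seq H) : 3 <= size c -> ucycle adj c ->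
  exists2 c' : seq G, ucycle adj c' & c = map inl c'.
Proof.
move=> sz_c /andP[cyc_c Uc].
have [c' def_c] : exists c', c = map (inl : G -> H) c'.
  have: forall a, a \in c -> exists x : G, a = inl x.
    move=> [x|i] ci; first by exists x.
    have := next_next_neq Uc sz_c (etrans (mem_prev c (inr i : H)) ci).
    rewrite next_prev // => /eqP[].
    have := prev_cycle cyc_c ci; have := next_cycle cyc_c ci.
    by case: (next _ _) (prev _ _) => [y|j] [z|l] //= /eqP-> /eqP->.
  elim: {cyc_c Uc sz_c} c => [|a s IHs] inl_s; first by exists [::].
  have [x ->] := inl_s a (mem_head _ _).
  have [|s' ->] := IHs; last by exists (x :: s').
  by move=> b sb; apply: inl_s; rewrite inE sb orbT.
exists c' => //; move: cyc_c Uc; rewrite def_c /ucycle.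
rewrite (map_inj_uniq (@inl_inj _ _)) => + ->.
by rewrite (@cycle_map _ _ (inl : G -> H)) => ->.
Qed.

Lemma cycle_edges_attach (c : seq G) : uniq c ->
  cycle_edges (map (inl : G -> H) c) =
  [set [set inl x | x in (A : {set G})] | A in cycle_edges c] :> {set {set H}}.
Proof.
move=> Uc; rewrite /cycle_edges -imset_comp.
apply/setP=> A; apply/imsetP/imsetP=> [[_ /mapP[x cx ->] ->]|[x cx ->]].
  by exists x => //=; rewrite next_map ?imsetU1 ?imset_set1 //; exact: inl_inj.
exists (inl x); first exact: map_f.
by rewrite /= next_map ?imsetU1 ?imset_set1 //; exact: inl_inj.
Qed.

(** Every cycle of H is the image of a cycle of G under the injection [inl], which preserves the
    number of edges. *)
Lemma triangle_unicyclic_attach (n : nat) :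
  triangle_unicyclic n G -> triangle_unicyclic (n + k) H.
Proof.
case=> cardG [connG [C [[c [sz_c ucyc_c def_C]] uniqC]]] C3.
have Uc : uniq c by case/andP: ucyc_c.
have cycH C' : is_cycle C' -> C' = cycle_edges (map (inl : G -> H) c).
  case=> c' [sz_c' ucyc_c' ->].
  have [c0 ucyc_c0 def_c'] := attach_cycle sz_c' ucyc_c'.
  have Uc0 : uniq c0 by case/andP: ucyc_c0.
  rewrite def_c' !cycle_edges_attach // -def_C -(uniqC (cycle_edges c0)) //.
  by exists c0; split=> //; rewrite -(size_map (inl : G -> H)) -def_c'.
split; first by rewrite card_attach cardG.
  split; first exact: connected_attach.
  exists (cycle_edges (map (inl : G -> H) c)); split=> [|C' /cycH //].
  exists (map inl c); split; rewrite ?size_map //.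
  case/andP: ucyc_c => cyc_c _; rewrite /ucycle map_inj_uniq ?Uc //.
    by rewrite andbT (@cycle_map _ _ (inl : G -> H)).
  exact: inl_inj.
move=> C' /cycH ->; rewrite cycle_edges_attach // card_imset.
  by apply: C3; exists c.
exact/imset_inj/inl_inj.
Qed.

End Attach.

(** * The triangle and the F-indices of the named graphs *)

Lemma triangle_unicyclic_triangle : triangle_unicyclic 3 triangle.
Proof.
have card3 (c : seq triangle) : 3 <= size c -> uniq c -> size c = 3.
  move=> sz_c Uc; apply/eqP; rewrite eqn_leq sz_c andbT.
  by have := max_card (mem c); rewrite (card_uniqP Uc) card_ord.
(* A cycle has three edges here, and three vertices have only three pairs, so the cycle uses all of
   them. *)
have cycE C : @is_cycle triangle C -> C = [set A : {set triangle} | #|A| == 2].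
  case=> c [sz_c /andP[cyc_c Uc] ->]; apply/eqP; rewrite eqEcard.
  rewrite card_cycle_edges // card_draws card_ord card3 // andbT.
  apply/subsetP=> A /imsetP[x cx ->].
  by have := next_cycle cyc_c cx; rewrite inE cards2 /= /triangle_adj => ->.
have cyc : is_cycle (cycle_edges [:: tx; ty; tz]) by exists [:: tx; ty; tz].
split; first exact: card_ord.
  split=> [x y|].
    by have [->|neq_xy] := eqVneq x y; [exact: connect0|exact: connect1].
  exists (cycle_edges [:: tx; ty; tz]); split=> // C' /cycE ->.
  by rewrite (cycE _ cyc).
by move=> C [c [sz_c /andP[_ Uc] ->]]; rewrite card_cycle_edges // card3.
Qed.

Lemma deg_triangle (x : triangle) : deg x = 2.
Proof.
rewrite /deg (_ : [set u | adj x u] = [set~ x]).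
  by rewrite cardsC1 card_ord.
by apply/setP=> u; rewrite !inE eq_sym.
Qed.

Lemma Findex_triangle : Findex triangle = 24.
Proof.
rewrite /Findex; under eq_bigr => x _ do rewrite deg_triangle.
by rewrite sum_nat_const card_ord.
Qed.

Lemma Findex_Rgraph k l (w : 'I_k) :
  Findex (Rgraph l w) = (k + 2) ^ 3 + l.+1 ^ 3 + 15 + k + l.
Proof.
rewrite !Findex_attach deg_attach_inr Findex_triangle !deg_triangle /=.
rewrite add1n (addnC 2).
have : 2 ^ 3 <= (k + 2) ^ 3 by rewrite leq_exp2r; lia.
have : 1 ^ 3 <= l.+1 ^ 3 by rewrite leq_exp2r.
lia.
Qed.

Section Families.
Variables (n : nat) (hn : 9 <= n).

Lemma Findex_G31 : Findex (G31 n) = n.-1 ^ 3 + 16 + (n - 3).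
Proof.
rewrite Findex_attach Findex_triangle deg_triangle.
rewrite (_ : 2 + (n - 3) = n.-1); last by lia.
by have : 2 ^ 3 <= n.-1 ^ 3; [rewrite leq_exp2r|]; lia.
Qed.

Lemma Findex_G32 : Findex (G32 n) = (n - 2) ^ 3 + 35 + (n - 3).
Proof.
rewrite !Findex_attach deg_attach_inl Findex_triangle !deg_triangle /=.
rewrite (_ : 2 + (n - 4) = n - 2); last by lia.
by have : 2 ^ 3 <= (n - 2) ^ 3; [rewrite leq_exp2r|]; lia.
Qed.

Lemma Findex_G31' (i : 'I_(n - 1 - 3)) :
  Findex (G31' i) = (n - 2) ^ 3 + 24 + (n - 4).
Proof.
rewrite !Findex_attach deg_attach_inr Findex_triangle !deg_triangle /=.
rewrite (_ : 2 + (n - 1 - 3) = n - 2); last by lia.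
by have : 2 ^ 3 <= (n - 2) ^ 3; [rewrite leq_exp2r|]; lia.
Qed.

Lemma Findex_G33 : Findex (G33 n) = (n - 3) ^ 3 + 72 + (n - 3).
Proof.
rewrite !Findex_attach deg_attach_inl Findex_triangle !deg_triangle /=.
rewrite (_ : 2 + (n - 5) = n - 3); last by lia.
by have : 2 ^ 3 <= (n - 3) ^ 3; [rewrite leq_exp2r|]; lia.
Qed.

Lemma Findex_G34 : Findex (G34 n) = (n - 3) ^ 3 + 54 + (n - 3).
Proof.
rewrite !Findex_attach !deg_attach_inl Findex_triangle !deg_triangle /=.
rewrite (_ : 2 + (n - 5) = n - 3); last by lia.
by have : 2 ^ 3 <= (n - 3) ^ 3; [rewrite leq_exp2r|]; lia.
Qed.

Lemma triangle_unicyclic_families (i : 'I_(n - 1 - 3)) :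
  [/\ triangle_unicyclic n (G31 n), triangle_unicyclic n (G32 n),
      triangle_unicyclic n (G31' i), triangle_unicyclic n (G33 n)
    & triangle_unicyclic n (G34 n)].
Proof.
have T k (x : triangle) : triangle_unicyclic (3 + k) (attach_leaves x k).
  exact/triangle_unicyclic_attach/triangle_unicyclic_triangle.
split.
- by have := T (n - 3) tx; rewrite subnKC //; lia.
- have := triangle_unicyclic_attach (inl ty : attach_leaves tx (n - 4)) 1 (T _ tx).
  by rewrite (_ : 3 + _ + 1 = n) //; lia.
- have := triangle_unicyclic_attach (inr i : G31 (n - 1)) 1 (T _ tx).
  by rewrite (_ : 3 + _ + 1 = n) //; lia.
- have := triangle_unicyclic_attach (inl ty : attach_leaves tx (n - 5)) 2 (T _ tx).
  by rewrite (_ : 3 + _ + 2 = n) //; lia.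
pose G1 := attach_leaves (inl ty : attach_leaves tx (n - 5)) 1.
have T1 := triangle_unicyclic_attach (inl ty : attach_leaves tx (n - 5)) 1 (T _ tx).
have := triangle_unicyclic_attach (inl (inl tz) : G1) 1 T1.
by rewrite (_ : 3 + _ + 1 + 1 = n) //; lia.
Qed.

Lemma Findex_families (i : 'I_(n - 1 - 3)) :
  [/\ Findex (G31 n) > Findex (G32 n), Findex (G32 n) > Findex (G31' i),
      Findex (G31' i) > Findex (G33 n) & Findex (G33 n) > Findex (G34 n)].
Proof.
rewrite Findex_G31 Findex_G32 Findex_G31' Findex_G33 Findex_G34.
(* Writing n as m + 9 removes the truncated subtractions and leaves polynomial inequalities in m. *)
have [m ->] : exists m, n = m + 9 by exists (n - 9); rewrite subnK.
rewrite (_ : (m + 9).-1 = m + 8) 1?(_ : m + 9 - 2 = m + 7) 1?(_ : m + 9 - 3 = m + 6);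
  [split; nia|lia..].
Qed.

End Families.

Lemma Rgraph_bound n k l (w : 'I_k) : 9 <= n -> 2 <= l -> k + l + 3 = n ->
  triangle_unicyclic n (Rgraph l w) /\ Findex (Rgraph l w) < Findex (G34 n).
Proof.
move=> hn le2l def_n; split.
  rewrite (_ : n = 3 + k + l); last by lia.
  exact/triangle_unicyclic_attach/triangle_unicyclic_attach/triangle_unicyclic_triangle.
rewrite Findex_Rgraph Findex_G34 // (_ : n - 3 = k + l); last by lia.
(* With k = k' + 1 and l = l' + 2 the two cubes become (k' + 3)^3 and (l' + 3)^3, and the difference
   of the two sides is 3k'l'(k' + l' + 6) + 12. *)
have [k' ->] : exists k', k = k'.+1 by exists k.-1; have := ltn_ord w; lia.
have [l' ->] : exists l', l = l' + 2 by exists (l - 2); lia.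
rewrite !expnS !expn0; nia.
Qed.

(** * Convexity estimates *)

(** For the excess e = d - 1 one has d^3 - 1 = e(e^2 + 3e + 3), and the second factor increases with
    e. *)
Lemma cube_excess_bound d B : 1 <= d <= B.+1 ->
  d ^ 3 <= 1 + d.-1 * (B ^ 2 + 3 * B + 3).
Proof.
case: d => // e /= le_eB.
have [t ->] : exists t, B = e + t by exists (B - e); lia.
rewrite !expnS !expn0; nia.
Qed.

Lemma sum_cube_excess (I : finType) (P : pred I) (d : I -> nat) B :
  (forall i, P i -> 1 <= d i <= B.+1) ->
  \sum_(i | P i) d i ^ 3 <=
    \sum_(i | P i) 1 + (\sum_(i | P i) (d i).-1) * (B ^ 2 + 3 * B + 3).
Proof.
move=> dB; rewrite big_distrl -big_split /=.
by apply: leq_sum => i /dB/cube_excess_bound.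
Qed.

(* [(e + 1) ^ 3 - 8 = (e - 1) (e ^ 2 + 4 e + 7)] for the excess [e = a + 1]. *)
Lemma cube_chord_bound a K : a.+1 <= K ->
  a.+2 ^ 3 <= 8 + a * (K ^ 2 + 4 * K + 7).
Proof.
move=> le_aK; have [t ->] : exists t, K = a.+1 + t by exists (K - a.+1); lia.
rewrite !expnS !expn0; nia.
Qed.

(** Here M is the excess of the vertex of maximal degree and s what the other vertices have beyond
    the two forced units of the triangle vertices. Each unit of s adds at most K^2 + 4K + 7 to the
    cubes, with K the minimum below; for s at least 3 this stays short of F(G34). *)
Lemma large_rest_estimate M s : 1 <= M -> 7 <= M + s -> 3 <= s ->
  M.+1 ^ 3 + 16 + s * (minn M s.+1 ^ 2 + 4 * minn M s.+1 + 7)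
  < (M + s - 1) ^ 3 + 54.
Proof.
move=> M1 ge7 ge3; have [Ms|sM] := leqP M s.
  rewrite (_ : minn M s.+1 = M); last by lia.
  have [t Et] : exists t, s = M + t by exists (s - M); lia.
  (* The values M = 1, 2, 3 are treated apart, since there the bound 7 on M + s forces t to be
     positive. From M = 4 on it holds by itself. *)
  subst s; case: M M1 ge7 {Ms ge3} => // -[|[|[|q]]] _ ge7.
  - have [r ->] : exists r, t = r + 5 by exists (t - 5); lia.
    rewrite (_ : _ + _ - 1 = r + 6); last by lia.
    rewrite !expnS !expn0; nia.
  - have [r ->] : exists r, t = r + 3 by exists (t - 3); lia.
    rewrite (_ : _ + _ - 1 = r + 6); last by lia.
    rewrite !expnS !expn0; nia.
  - have [r ->] : exists r, t = r + 1 by exists (t - 1); lia.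
    rewrite (_ : _ + _ - 1 = r + 6); last by lia.
    rewrite !expnS !expn0; nia.
  - rewrite (_ : _ + _ - 1 = q + q + 7 + t); last by lia.
    rewrite !expnS !expn0; nia.
rewrite (_ : minn M s.+1 = s.+1); last by lia.
have [t Et] : exists t, M = s + t.+1 by exists (M - s.+1); lia.
have [q Eq] : exists q, s = q + 3 by exists (s - 3); lia.
subst M s; rewrite (_ : _ + _ - 1 = q + q + t + 6); last by lia.
rewrite !expnS !expn0; nia.
Qed.

(** The degrees are M + 1, a + 2 and b + 2, and r is the total excess elsewhere. The contributions 1
    of the n - 3 other vertices are cancelled against the summand n - 3 of F(G34). *)
Lemma extremal_excess n M a b r : 9 <= n -> M + a + b + r + 2 = n ->
  a.+1 <= M -> b.+1 <= M ->
  (n - 3) ^ 3 + 54 <=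
    M.+1 ^ 3 + a.+2 ^ 3 + b.+2 ^ 3 + r * (minn M r ^ 2 + 3 * minn M r + 3) ->
  (a, b, r) \in [:: (0, 0, 0); (1, 0, 0); (0, 1, 0); (0, 0, 1);
                    (2, 0, 0); (0, 2, 0); (1, 1, 0)].
Proof.
move=> hn def_n aM bM; apply: contraLR; rewrite -ltnNge => notin.
have [ge3|lt3] := leqP 3 (a + b + r).
  (* K bounds a + 1, b + 1 and [minn M r], so a single slope serves all three terms. *)
  set K := minn M (a + b + r).+1.
  have := @large_rest_estimate M (a + b + r); rewrite -/K.
  rewrite (_ : M + (a + b + r) - 1 = n - 3); last by lia.
  have ca : a.+2 ^ 3 <= 8 + a * (K ^ 2 + 4 * K + 7) by apply: cube_chord_bound; lia.
  have cb : b.+2 ^ 3 <= 8 + b * (K ^ 2 + 4 * K + 7) by apply: cube_chord_bound; lia.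
  have cr : r * (minn M r ^ 2 + 3 * minn M r + 3) <= r * (K ^ 2 + 4 * K + 7).
    rewrite leq_mul2l; apply/orP; right.
    have : minn M r <= K by lia.
    by move: (minn M r) => B BK; rewrite !expnS !expn0; nia.
  have M1 : 1 <= M by lia.
  have ge7 : 7 <= M + (a + b + r) by lia.
  move=> /(_ M1 ge7 ge3); lia.
have EM : n - 3 = M + (a + b + r) - 1 by lia.
rewrite EM; move: notin lt3 {aM bM def_n EM hn}.
case: a => [|[|[|a]]]; case: b => [|[|[|b]]]; case: r => [|[|[|r]]];
  rewrite ?inE //= => _ lt3; try by exfalso; lia.
(* The triples left are (0,0,2), (1,0,1) and (0,1,1). Their sum is 2, so n - 3 = M + 1 and the large
   cubes cancel; the remaining terms are at most 42, below 54. *)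
all: rewrite (_ : M + _ - 1 = M.+1); last by lia.
all: rewrite ?addn0 ?add0n -addnA -addnA ltn_add2l.
all: move: (minn _ _) (geq_minr M 1) (geq_minr M 2) => B B1 B2.
all: rewrite !expnS !expn0; nia.
Qed.

(** * Recognising the extremal graphs *)

(** This is an isomorphism onto an induced subgraph, so equal vertex numbers make it an
    isomorphism. *)
Definition embedding (H G : sgraph) (g : H -> G) :=
  injective g /\ {mono g : x y / adj x y}.

Lemma embedding_isomorphic (H G : sgraph) (g : H -> G) :
  embedding g -> #|H| = #|G| -> isomorphic G H.
Proof.
case=> g_inj g_mono cardHG.
have [f gK fK] := inj_card_bij g_inj (eq_leq (esym cardHG)).
by exists f; [exists g | move=> x y; rewrite -g_mono !fK].
Qed.

Section Extension.
Variables (H G : sgraph) (g : H -> G) (v : H) (k : nat).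
Hypothesis g_emb : embedding g.

Definition extend_embedding (h : 'I_k -> G) (a : attach_leaves v k) : G :=
  match a with inl x => g x | inr i => h i end.

Lemma extend_embeddingP (h : 'I_k -> G) : injective h ->
  (forall i x, h i != g x) -> (forall i x, adj (h i) (g x) = (x == v)) ->
  (forall i j, adj (h i) (h j) = false) ->
  embedding (extend_embedding h).
Proof.
case: g_emb => g_inj g_mono h_inj h_notin h_v h_h.
split=> [[x|i] [y|j] /= | [x|i] [y|j] //=].
- by move/g_inj->.
- by move/esym/eqP; rewrite (negbTE (h_notin _ _)).
- by move/eqP; rewrite (negbTE (h_notin _ _)).
- by move/h_inj->.
- by rewrite adj_sym h_v.
Qed.

Lemma enum_set_ord (T : finType) (L : {set T}) : #|L| = k ->
  exists2 h : 'I_k -> T, injective h & forall i, h i \in L.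
Proof.
move=> cardL; exists (fun i => enum_val (cast_ord (esym cardL) i)).
  by move=> i j /enum_val_inj/cast_ord_inj.
by move=> i; apply: enum_valP.
Qed.

(** In [G31'] the index i of the leaf that is extended is prescribed; a transposition makes the
    enumeration send it to u. *)
Lemma enum_set_ord_at (T : finType) (L : {set T}) (i : 'I_k) u :
  #|L| = k -> u \in L ->
  exists h : 'I_k -> T, [/\ injective h, forall i, h i \in L & h i = u].
Proof.
move=> cardL Lu; have [h h_inj hL] := enum_set_ord cardL.
have : u \in [set h j | j in 'I_k].
  suff -> : [set h j | j in 'I_k] = L by [].
  apply/eqP; rewrite eqEcard card_imset // card_ord cardL leqnn andbT.
  by apply/subsetP=> _ /imsetP[j _ ->].
case/imsetP=> j _ def_u; exists (h \o tperm i j); split=> //=.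
  exact: inj_comp h_inj perm_inj.
by rewrite tpermL.
Qed.

Lemma deg1_adj (u w : G) : deg u = 1 -> adj u w -> forall x, adj u x = (x == w).
Proof.
move/eqP/cards1P=> [w' Nu] uw x.
have adjE y : adj u y = (y == w') by have := in_set1 y w'; rewrite -Nu inE.
by move: uw; rewrite !adjE => /eqP->.
Qed.

(** A vertex of degree 1 adjacent to [g v] has no other neighbour, so all adjacencies required of
    the new leaves follow, including that no two of them are adjacent. *)
Lemma extend_by_leaves (L : {set G}) : #|L| = k ->
  {in L, forall u, [/\ deg u = 1, adj u (g v) & forall x, u != g x]} ->
  exists g' : attach_leaves v k -> G,
    [/\ embedding g', forall x, g' (inl x) = g x & forall i, g' (inr i) \in L].
Proof.
move=> cardL leafL; have [h h_inj hL] := enum_set_ord cardL.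
exists (extend_embedding h); split=> //; case: (g_emb) => g_inj _.
apply: extend_embeddingP => // [i x|i x|i j]; have [deg1 adj_v notin] := leafL _ (hL i).
- exact: notin.
- by rewrite (deg1_adj deg1 adj_v) inj_eq.
- have [_ _ notin_j] := leafL _ (hL j).
  by rewrite (deg1_adj deg1 adj_v) (negbTE (notin_j v)).
Qed.

End Extension.

Section Recognise.
Variables (n : nat) (G : sgraph) (m a b : G).
Hypotheses (hn : 9 <= n) (cardG : #|G| = n).
Hypotheses (adj_ma : adj m a) (adj_ab : adj a b) (adj_bm : adj b m).

Lemma adj_neq (x y : G) : adj x y -> x != y.
Proof. by apply: contraTneq => ->; rewrite adj_irr. Qed.

Local Notation T := [set m; a; b].

(** The order sends [tx], [ty], [tz] to m, a, b; the default of [nth] is never reached. *)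
Definition triangle_map (i : triangle) : G := nth m [:: m; a; b] i.

Lemma triangle_map_embedding : embedding triangle_map.
Proof.
have mono_g : {mono triangle_map : x y / adj x y}.
  case=> [[|[|[|//]]] ?] [[|[|[|//]]] ?]; rewrite /triangle_map /= ?adj_irr //;
  by rewrite ?adj_ma ?adj_ab ?adj_bm // adj_sym ?adj_ma ?adj_ab ?adj_bm.
(* Distinct vertices of the triangle are adjacent, so equal images would yield a loop. *)
split=> // x y Exy; apply/eqP; apply: contraFT (adj_irr (triangle_map x)).
by rewrite {2}Exy mono_g.
Qed.

Lemma triangle_map_in i : triangle_map i \in T.
Proof. by case: i => [[|[|[|//]]] ?]; rewrite !inE eqxx ?orbT. Qed.

Lemma cardT : #|T| = 3.
Proof.
by rewrite -setUA !cardsU1 cards1 !inE negb_or (eq_sym m b) !adj_neq.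
Qed.

Definition outer_nbrs (x : G) : {set G} := [set u | adj x u] :\: T.

Lemma adj_in_triangle : {in T &, forall x u, adj x u = (u != x)}.
Proof.
have adj_am : adj a m by rewrite adj_sym.
have adj_mb : adj m b by rewrite adj_sym.
have adj_ba : adj b a by rewrite adj_sym.
move=> x u; rewrite !inE -!orbA => /or3P[] /eqP-> /or3P[] /eqP->;
  by rewrite ?adj_irr ?eqxx ?adj_neq ?adj_ma ?adj_ab ?adj_bm ?adj_am ?adj_mb ?adj_ba.
Qed.

Lemma card_outer_nbrs x : x \in T -> #|outer_nbrs x| = deg x - 2.
Proof.
move=> Tx; rewrite cardsD (_ : _ :&: _ = T :\ x).
  by have := cardsD1 x T; rewrite Tx cardT add1n => -[<-].
apply/setP=> u; rewrite in_setI in_setD1 [u \in [set _ | _]]inE andbC [RHS]andbC.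
by case Tu: (u \in T); rewrite //= adj_in_triangle.
Qed.

Lemma adj_triangle_deg2 x u : x \in T -> deg x = 2 -> adj x u -> u \in T.
Proof.
move=> Tx deg_x xu; have := card_outer_nbrs Tx; rewrite deg_x => /eqP.
rewrite cards_eq0 => /eqP/setP/(_ u); rewrite in_set0 in_setD inE xu andbT.
by move/negbFE.
Qed.

Lemma triangle_map_notin u x : u \notin T -> u != triangle_map x.
Proof. by apply: contraNneq => ->; exact: triangle_map_in. Qed.

Lemma outer_nbrsP x u : reflect (u \notin T /\ adj u x) (u \in outer_nbrs x).
Proof. by rewrite in_setD inE (adj_sym x); exact: andP. Qed.

Section AllLeaves.
Hypothesis leaves : forall u, u \notin T -> deg u = 1.

Lemma outer_nbrs_inj x y u : u \in outer_nbrs x -> u \in outer_nbrs y -> x = y.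
Proof.
case/outer_nbrsP=> T'u ux /outer_nbrsP[_ uy].
by move: uy; rewrite (deg1_adj (leaves T'u) ux) => /eqP.
Qed.

Lemma attach_outer_nbrs (H : sgraph) (g : H -> G) (v : H) k : embedding g ->
  #|outer_nbrs (g v)| = k -> (forall x, g x \notin outer_nbrs (g v)) ->
  exists g' : attach_leaves v k -> G,
    [/\ embedding g', forall x, g' (inl x) = g x
      & forall i, g' (inr i) \in outer_nbrs (g v)].
Proof.
move=> g_emb card_v notin; apply: extend_by_leaves => // u Lu.
have [T'u uv] := outer_nbrsP _ _ Lu; split=> //; first exact: leaves.
by move=> x; apply: contraNneq (notin x) => <-.
Qed.

Lemma attach_outer_nbrs_m k : deg m = k + 2 ->
  exists g : attach_leaves tx k -> G,
    [/\ embedding g, forall x, g (inl x) = triangle_map x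
      & forall i, g (inr i) \in outer_nbrs m].
Proof.
move=> deg_m; apply: (attach_outer_nbrs triangle_map_embedding).
  by rewrite card_outer_nbrs ?deg_m ?addnK // !inE eqxx.
by move=> x; apply/negP=> /outer_nbrsP[]; rewrite triangle_map_in.
Qed.

Lemma attach_outer_nbrs_ma k l : deg m = k + 2 -> deg a = l + 2 ->
  exists g : attach_leaves (inl ty : attach_leaves tx k) l -> G,
    [/\ embedding g, forall x, g (inl (inl x)) = triangle_map x,
      forall i, g (inl (inr i)) \in outer_nbrs m
      & forall i, g (inr i) \in outer_nbrs a].
Proof.
move=> deg_m deg_a; have [g [g_emb gT gm]] := attach_outer_nbrs_m deg_m.
have Ea : g (inl ty) = a by rewrite gT.
have [] := attach_outer_nbrs (v := inl ty : attach_leaves tx k) (k := l) g_emb.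
- by rewrite Ea card_outer_nbrs ?deg_a ?addnK // !inE eqxx orbT.
- rewrite Ea => -[x|i]; apply/negP.
    by rewrite gT => /outer_nbrsP[]; rewrite triangle_map_in.
  move/outer_nbrs_inj/(_ (gm i)) => Eam.
  by have := adj_neq adj_ma; rewrite Eam eqxx.
rewrite Ea => g' [g'_emb g'l g'r]; exists g'; split=> // [x|i]; by rewrite g'l.
Qed.

(** The degree of m yields n - 3 leaves, which together with the triangle exhaust G. The next three
    lemmas count in the same way. *)
Lemma recognise_G31 : deg m = n.-1 -> isomorphic G (G31 n).
Proof.
move=> deg_m; have [|g [g_emb _ _]] := @attach_outer_nbrs_m (n - 3); first by lia.
by apply: embedding_isomorphic g_emb _; rewrite card_attach card_ord cardG; lia.
Qed.

Lemma recognise_G32 : deg m = n - 2 -> deg a = 3 -> isomorphic G (G32 n).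
Proof.
move=> deg_m deg_a.
have [||g [g_emb _ _ _]] := @attach_outer_nbrs_ma (n - 4) 1; try lia.
by apply: embedding_isomorphic g_emb _; rewrite !card_attach card_ord cardG; lia.
Qed.

Lemma recognise_G33 : deg m = n - 3 -> deg a = 4 -> isomorphic G (G33 n).
Proof.
move=> deg_m deg_a.
have [||g [g_emb _ _ _]] := @attach_outer_nbrs_ma (n - 5) 2; try lia.
by apply: embedding_isomorphic g_emb _; rewrite !card_attach card_ord cardG; lia.
Qed.

Lemma recognise_G34 : deg m = n - 3 -> deg a = 3 -> deg b = 3 ->
  isomorphic G (G34 n).
Proof.
move=> deg_m deg_a deg_b.
have [||g [g_emb gT gm ga]] := @attach_outer_nbrs_ma (n - 5) 1; try lia.
have Eb : g (inl (inl tz)) = b by rewrite gT.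
have [] := attach_outer_nbrs
  (v := inl (inl tz) : attach_leaves (inl ty : attach_leaves tx (n - 5)) 1)
  (k := 1) g_emb.
- by rewrite Eb card_outer_nbrs ?deg_b // !inE eqxx orbT.
- rewrite Eb => -[[x|i]|i]; apply/negP.
  + by rewrite gT => /outer_nbrsP[]; rewrite triangle_map_in.
  + move/outer_nbrs_inj/(_ (gm i)) => Ebm.
    by have := adj_neq adj_bm; rewrite Ebm eqxx.
  + move/outer_nbrs_inj/(_ (ga i)) => Eba.
    by have := adj_neq adj_ab; rewrite Eba eqxx.
move=> g' [g'_emb _ _]; apply: embedding_isomorphic g'_emb _.
by rewrite !card_attach card_ord cardG; lia.
Qed.

End AllLeaves.

Lemma recognise_G31' (i : 'I_(n - 1 - 3)) u : deg m = n - 2 ->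
  deg a = 2 -> deg b = 2 -> u \notin T -> deg u = 2 ->
  (forall w, w \notin T -> w != u -> deg w = 1) -> isomorphic G (G31' i).
Proof.
move=> deg_m deg_a deg_b T'u deg_u leaves.
have Tm : m \in T by rewrite !inE eqxx.
have Ta : a \in T by rewrite !inE eqxx orbT.
have Tb : b \in T by rewrite !inE eqxx orbT.
have nadj_ab w x : w \notin T -> x \in T -> adj w x -> x = m.
  move=> T'w; rewrite !inE -orbA => /or3P[/eqP //||] /eqP-> wx; case/negP: T'w.
    by apply: adj_triangle_deg2 Ta deg_a _; rewrite adj_sym.
  by apply: adj_triangle_deg2 Tb deg_b _; rewrite adj_sym.
have card_m : #|outer_nbrs m| = n - 1 - 3 by rewrite card_outer_nbrs // deg_m; lia.
(* Otherwise the n - 4 outer neighbours of m are all the vertices off the triangle except u. A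
   neighbour w of u is then a leaf adjacent to both u and m, which is impossible. *)
have um : adj u m.
  apply/negPn/negP=> u'm.
  have outerE : outer_nbrs m = ~: T :\ u.
    apply/eqP; rewrite eqEcard card_m; apply/andP; split.
      apply/subsetP=> w /outer_nbrsP[T'w wm]; rewrite in_setD1 in_setC T'w andbT.
      by apply: contraNneq u'm => <-.
    have := cardsC T; rewrite cardT (cardsD1 u (~: T)) in_setC T'u cardG; lia.
  have [w uw] : exists w, adj u w.
    by have /card_gt0P[w] : 0 < deg u; [rewrite deg_u | rewrite inE; exists w].
  have T'w : w \notin T.
    by apply/negP=> /nadj_ab-/(_ _ T'u uw) Ew; rewrite -Ew uw in u'm.
  have neq_wu : w != u by rewrite eq_sym adj_neq.
  have : w \in outer_nbrs m by rewrite outerE in_setD1 neq_wu in_setC T'w.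
  case/outer_nbrsP=> _; rewrite (deg1_adj (leaves w T'w neq_wu) (w := u)).
    by move=> /eqP Em; rewrite -Em Tm in T'u.
  by rewrite adj_sym.
have [w uw neq_wm] : exists2 w, adj u w & w != m.
  have : 0 < #|[set w | adj u w] :\ m|.
    by have := cardsD1 m [set w | adj u w]; rewrite -/(deg u) deg_u inE um; case: #|_|.
  by case/card_gt0P=> w; rewrite !inE => /andP[]; exists w.
have T'w : w \notin T.
  by apply: contra neq_wm => /nadj_ab-/(_ _ T'u uw)->.
have neq_wu : w != u by rewrite eq_sym adj_neq.
have deg_w := leaves w T'w neq_wu.
have wu : adj w u by rewrite adj_sym.
have Lu : u \in outer_nbrs m by apply/outer_nbrsP.
(* Of two distinct outer neighbours of m one differs from u, hence is a leaf whose only neighbour is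
   m. *)
have outer_adj x y : x \in outer_nbrs m -> y \in outer_nbrs m -> adj x y = false.
  suff leaf_adj s t : s \in outer_nbrs m -> t \in outer_nbrs m -> s != u ->
      adj s t = false.
    move=> Lx Ly; have [Exu|] := eqVneq x u; last exact: leaf_adj.
    have [Eyu|neq_yu] := eqVneq y u; first by rewrite Exu Eyu adj_irr.
    by rewrite adj_sym leaf_adj.
  case/outer_nbrsP=> T's sm /outer_nbrsP[T't _] neq_su.
  rewrite (deg1_adj (leaves s T's neq_su) sm).
  by apply: contraNF T't => /eqP->.
have [h [h_inj hL hi]] := enum_set_ord_at i card_m Lu.
have g_emb : embedding (extend_embedding (v := tx) triangle_map h).
  apply: extend_embeddingP triangle_map_embedding _ h_inj _ _ _ => [j x|j x|j1 j2].
  - by apply: triangle_map_notin; have [] := outer_nbrsP _ _ (hL j).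
  - have [T'j jm] := outer_nbrsP _ _ (hL j); apply/idP/eqP=> [|->//].
    move/(nadj_ab _ _ T'j (triangle_map_in x)) => Exm.
    by have [g_inj _] := triangle_map_embedding; apply: g_inj.
  - exact: outer_adj.
have [] := @extend_by_leaves _ _ _ (inr i : G31 (n - 1)) 1 g_emb [set w].
- exact: cards1.
- move=> _ /set1P->; split; rewrite //= ?hi // => -[x|j] /=.
    exact: triangle_map_notin.
  apply: contraTneq wu => ->; rewrite outer_adj //.
move=> g' [g'_emb _ _]; apply: embedding_isomorphic g'_emb _.
by have [_ _ [-> _ _] _ _] := triangle_unicyclic_families hn i.
Qed.

End Recognise.

(** * Extremality *)

Lemma deg_ge2 (G : sgraph) (x y z : G) :
  adj x y -> adj x z -> y != z -> 2 <= deg x.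
Proof.
(* The cardinality of a pair is [(y != z).+1], so 2 is written in that form. *)
move=> xy xz neq_yz; rewrite -[2]/(true.+1) -neq_yz -cards2.
by apply: subset_leq_card; apply/subsetP=> u; rewrite !inE => /orP[]/eqP->.
Qed.

Lemma deg_gt0 (G : sgraph) (v : G) : connected G -> 1 < #|G| -> 0 < deg v.
Proof.
move=> connG card_gt1.
have [||u [w [/set1P-> _ vw]]] := @exists_boundary_edge G connG [set v].
- by apply/set0Pn; exists v; rewrite set11.
- by apply: contraTneq card_gt1 => ET; rewrite -cardsT -ET cards1.
by apply/card_gt0P; exists w; rewrite inE.
Qed.

(** Growth starts at the vertex set of the triangle, where the three vertices have two neighbours
    each: 6 ordered pairs, twice the size. *)
Lemma triangle_unicyclic_sum_deg (n : nat) (G : sgraph) :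
  triangle_unicyclic n G ->
  exists x y z : G, [/\ adj x y, adj y z, adj z x & \sum_(v : G) deg v = n.*2].
Proof.
case=> cardG [connG [C [cycC uniqC]]] C3.
have := C3 _ cycC; have [c [sz_c ucyc_c def_C]] := cycC.
rewrite def_C card_cycle_edges //; last by case/andP: ucyc_c.
case: c sz_c ucyc_c def_C => [|x [|y [|z [|//]]]] //= _ /andP[] /=.
case/and4P=> xy yz zx _ _ def_C _; exists x, y, z; split=> //.
have adjT := adj_in_triangle xy yz zx.
rewrite -cardG; apply: (@sum_deg_growth G C [set x; y; z]) => //.
- by move=> C' /uniqC.
- move=> A; rewrite def_C => /cycle_edges_sub subA; apply/subsetP=> u /subA.
  by rewrite !inE orbA.
- by apply/set0Pn; exists x; rewrite !inE eqxx.
- move=> u w Tu Tw; have [->|neq_uw] := eqVneq u w; first exact: connect0.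
  by apply: connect1; rewrite /= Tu Tw adjT // eq_sym.
rewrite /edge_count (eq_bigr (fun=> 2)) => [|u Tu].
  by rewrite sum_nat_const muln2.
have := cardsD1 u [set x; y; z]; rewrite Tu cardT // add1n => -[->].
rewrite -sum1_card big_mkcond [RHS]big_mkcond; apply: eq_bigr => w _.
by rewrite in_setD1; case Tw: (w \in _); rewrite ?andbF // adjT // andbT; case: eqP.
Qed.

Lemma sum_split3 (T : finType) (m a b : T) (f : T -> nat) :
  a != m -> b != m -> b != a ->
  \sum_v f v = f m + f a + f b + \sum_(v | v \notin [set m; a; b]) f v.
Proof.
move=> am bm ba; rewrite (bigD1 m) //= (bigD1 a) //= (bigD1 b) /=; last by rewrite bm ba.
rewrite -!addnA; do 3!congr (_ + _); apply: eq_bigl => v.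
by rewrite !inE !negb_or.
Qed.

Definition excess_off (G : sgraph) (T : {set G}) :=
  \sum_(v | v \notin T) (deg v).-1.

Lemma excess_off_ge (G : sgraph) (T : {set G}) v :
  v \notin T -> (deg v).-1 <= excess_off T.
Proof. by move=> T'v; rewrite /excess_off (bigD1 v) //= leq_addr. Qed.

(** If m is on the triangle, a rotation puts it in the place of c; whether it is there stays open
    for now. *)
Lemma exists_pair_off (G : sgraph) (m x y z : G) :
  adj x y -> adj y z -> adj z x ->
  exists a b c : G, [/\ adj c a, adj a b, adj b c, a != m & b != m].
Proof.
move=> xy yz zx; have [<-|neq_xm] := eqVneq x m.
  by exists y, z, x; rewrite (eq_sym y) !adj_neq.
have [<-|neq_ym] := eqVneq y m.
  by exists z, x, y; rewrite (eq_sym z) !adj_neq.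
by exists x, y, z.
Qed.

Section Extremal.
Variables (n : nat) (G : sgraph) (m a b c : G).
Hypotheses (hn : 9 <= n) (cardG : #|G| = n) (deg_pos : forall v : G, 0 < deg v).
Hypotheses (sum_deg : \sum_(v : G) deg v = n.*2).
Hypothesis m_max : forall v : G, deg v <= deg m.
Hypotheses (ca : adj c a) (ab : adj a b) (bc : adj b c) (am : a != m) (bm : b != m).
Hypothesis large_F : Findex (G34 n) <= Findex G.

Local Notation T := [set m; a; b].
Local Notation r := (excess_off T).

(** The set T need not be the triangle yet. The linear relation is the degree sum 2n split over m,
    a, b and the rest. *)
Lemma excess_cases : exists i j,
  [/\ deg m + i + j + r + 1 = n, deg a = i + 2, deg b = j + 2
    & (i, j, r) \in [:: (0, 0, 0); (1, 0, 0); (0, 1, 0); (0, 0, 1);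
                        (2, 0, 0); (0, 2, 0); (1, 1, 0)]].
Proof.
have ba : b != a by rewrite eq_sym adj_neq.
have deg_a : 2 <= deg a by apply: (deg_ge2 ab _ (adj_neq bc)); rewrite adj_sym.
have deg_b : 2 <= deg b by apply: (deg_ge2 bc _ (adj_neq ca)); rewrite adj_sym.
have max_a := m_max a; have max_b := m_max b.
have split_sum f := sum_split3 f am bm ba.
have card_rest : \sum_(v | v \notin T) 1 = n - 3.
  by have := split_sum (fun=> 1); rewrite [LHS]sum1_card cardG; lia.
have def_r : \sum_(v | v \notin T) deg v = n - 3 + r.
  by rewrite -card_rest -big_split; apply: eq_bigr => v _ /=; have := deg_pos v; lia.
have def_n := split_sum (@deg G); rewrite sum_deg def_r in def_n.
exists (deg a - 2), (deg b - 2); split; try lia.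
(* A degree off T is bounded both by the maximal degree and by the total excess there. *)
have rest_bound v : v \notin T -> 1 <= deg v <= (minn (deg m).-1 r).+1.
  move=> /excess_off_ge; have := m_max v; have := deg_pos v; lia.
have := sum_cube_excess rest_bound; rewrite card_rest -/(excess_off T).
have := split_sum (fun v => deg v ^ 3); rewrite -/(Findex G).
move: large_F; rewrite Findex_G34 // => F_ge F_eq F_le.
apply: (@extremal_excess n (deg m).-1) => //; [lia|lia|lia|].
rewrite !(prednK (deg_pos _)).
have -> : (deg a - 2).+2 = deg a by lia.
have -> : (deg b - 2).+2 = deg b by lia.
move: F_ge F_eq F_le; set X := (n - 3) ^ 3; set Y := _ * (_ + _).
by clear; lia.
Qed.

Lemma recognise_extremal (i0 : 'I_(n - 1 - 3)) :
  [\/ isomorphic G (G31 n), isomorphic G (G32 n), isomorphic G (G31' i0)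
    | isomorphic G (G33 n) \/ isomorphic G (G34 n)].
Proof.
have [i [j [def_n deg_a deg_b cases]]] := excess_cases.
have deg_c : 2 <= deg c.
  by apply: (deg_ge2 ca _ (adj_neq ab)); rewrite adj_sym.
(* If c were not m, it would lie off T with excess at least 1, which leaves only the triple (0,0,1).
   Then a, b, c have degree 2 and m has no neighbour among them, yet its degree is n - 2 with just n
   - 3 vertices off the triangle. *)
have cm : c = m.
  apply/eqP/negPn/negP=> neq_cm.
  have T'c : c \notin T by rewrite !inE !negb_or neq_cm (adj_neq ca) eq_sym (adj_neq bc).
  have r_ge := excess_off_ge T'c.
  have [Ei [Ej Er]] : i = 0 /\ j = 0 /\ r = 1.
    move: cases r_ge deg_c; rewrite !inE !xpair_eqE.
    by move: r (deg c) => s d; clear; lia.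
  have m_out : m \notin [set c; a; b].
    by rewrite !inE !negb_or !(eq_sym m) neq_cm am bm.
  have : [set u | adj m u] \subset ~: [set c; a; b].
    apply/subsetP=> u; rewrite [u \in [set _ | _]]inE adj_sym in_setC => um.
    apply: contra m_out => Tu; apply: (adj_triangle_deg2 ca ab bc Tu) um.
    have deg_c2 : deg c = 2 by move: r_ge deg_c; rewrite Er; clear; lia.
    by move: Tu; rewrite !inE -orbA => /or3P[]/eqP->; rewrite ?deg_a ?deg_b ?Ei ?Ej.
  move/subset_leq_card; have := cardsC [set c; a; b].
  rewrite (cardT ca ab bc) cardG -/(deg m).
  by move: def_n; rewrite Ei Ej Er; clear; lia.
have [ma b_m] : adj m a /\ adj b m by rewrite -cm.
have mb : adj m b by rewrite adj_sym.
have ba : adj b a by rewrite adj_sym.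
have a_m : adj a m by rewrite adj_sym.
have [r1|r0] : r = 1 \/ r = 0.
  by move: cases; rewrite !inE !xpair_eqE; move: r => s; clear; lia.
  have [Ei Ej] : i = 0 /\ j = 0.
    by move: cases; rewrite r1 !inE !xpair_eqE; clear; lia.
  (* One vertex u carries the whole excess 1, so it has degree 2 and all others off the triangle are
     leaves. *)
  have [u T'u deg_u] : exists2 u, u \notin T & deg u != 1.
    apply/exists_inP; apply: contra_eqT r1; rewrite negb_exists_in => /forall_inP deg1.
    by rewrite /excess_off big1 // => u /deg1; rewrite negbK => /eqP->.
  have deg_u2 : deg u = 2.
    by move: (excess_off_ge T'u) (deg_pos u) deg_u; rewrite r1; clear; lia.
  have deg_m : deg m = n - 2 by move: def_n; rewrite r1 Ei Ej; clear; lia.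
  apply: Or43; apply: (@recognise_G31' n G m a b hn cardG ma ab b_m i0 u) => //.
  - by rewrite deg_a Ei.
  - by rewrite deg_b Ej.
  move=> w T'w neq_wu; have := deg_pos w.
  move: r1; rewrite /excess_off (bigD1 u) // (bigD1 w) /=; last by rewrite T'w.
  by rewrite deg_u2; clear; lia.
have leaves u : u \notin T -> deg u = 1.
  by move/excess_off_ge; rewrite r0; have := deg_pos u; lia.
(* Exchanging a and b covers the mirrored triples (0,1,0) and (0,2,0). *)
have leaves' u : u \notin [set m; b; a] -> deg u = 1.
  by rewrite setUAC; apply: leaves.
have : [\/ i = 0 /\ j = 0, i = 1 /\ j = 0 \/ i = 0 /\ j = 1,
           i = 2 /\ j = 0 \/ i = 0 /\ j = 2 | i = 1 /\ j = 1].
  have : (i = 0 /\ j = 0) \/ (i = 1 /\ j = 0 \/ i = 0 /\ j = 1) \/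
         (i = 2 /\ j = 0 \/ i = 0 /\ j = 2) \/ (i = 1 /\ j = 1).
    by move: cases; rewrite r0 !inE !xpair_eqE; clear; lia.
  by case=> [|[|[]]]; [exact: Or41|exact: Or42|exact: Or43|exact: Or44].
rewrite r0 in def_n; clear cases.
case=> [[Ei Ej]|[[Ei Ej]|[Ei Ej]]|[[Ei Ej]|[Ei Ej]]|[Ei Ej]]; subst i j.
- by apply: Or41; apply: (recognise_G31 hn cardG ma ab b_m leaves); lia.
- by apply: Or42; apply: (recognise_G32 hn cardG ma ab b_m leaves); lia.
- by apply: Or42; apply: (recognise_G32 hn cardG mb ba a_m leaves'); lia.
- by apply: Or44; left; apply: (recognise_G33 hn cardG ma ab b_m leaves); lia.
- by apply: Or44; left; apply: (recognise_G33 hn cardG mb ba a_m leaves'); lia.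
by apply: Or44; right; apply: (recognise_G34 hn cardG ma ab b_m leaves); lia.
Qed.

End Extremal.

Theorem theorem10 (n : nat) (hn : 9 <= n) (i : 'I_(n - 1 - 3)) :
  [/\ [/\ triangle_unicyclic n (G31 n), triangle_unicyclic n (G32 n),
          triangle_unicyclic n (G31' i), triangle_unicyclic n (G33 n)
        & triangle_unicyclic n (G34 n)],
      [/\ Findex (G31 n) > Findex (G32 n),
          Findex (G32 n) > Findex (G31' i),
          Findex (G31' i) > Findex (G33 n)
        & Findex (G33 n) > Findex (G34 n)],
      (forall (k l : nat) (w : 'I_k), 1 <= k -> 2 <= l -> k + l + 3 = n ->
         triangle_unicyclic n (Rgraph l w) /\
         Findex (G34 n) > Findex (Rgraph l w))
    & (forall G : sgraph, triangle_unicyclic n G ->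
         ~ isomorphic G (G31 n) -> ~ isomorphic G (G32 n) ->
         ~ isomorphic G (G31' i) -> ~ isomorphic G (G33 n) ->
         ~ isomorphic G (G34 n) ->
         Findex G < Findex (G34 n))].
Proof.
split.
- exact: triangle_unicyclic_families.
- exact: Findex_families.
- by move=> k l w _ le2l def_n; apply: Rgraph_bound.
move=> G tuG no31 no32 no31' no33 no34; rewrite ltnNge; apply/negP=> large_F.
have [x [y [z [xy yz zx sum_deg]]]] := triangle_unicyclic_sum_deg tuG.
have [cardG [connG _] _] := tuG.
case: (arg_maxnP (@deg G) (erefl : predT x)) => m _ m_max.
have [a [b [c [ca ab bc am bm]]]] := exists_pair_off m xy yz zx.
have deg_pos (v : G) : 0 < deg v by apply: deg_gt0 => //; rewrite cardG; lia.
have [//|//|//|[//|//]] :=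
  recognise_extremal hn cardG deg_pos sum_deg (fun v => m_max v isT) ca ab bc am bm large_F i.
Qed.
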